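(* Let $q$ be a prime power, $m,n$ positive integers with $2\le n\le m$, and let $\mathcal{C}\subseteq\mathbb{F}_q^{m\times n}$ be a nonzero $\mathbb{F}_q$-linear code with minimum rank distance $d$. Then 1. $\mathcal{W}^{\mathcal{P}}_{\mathcal{C}}(T)=q^dT\,\mathcal{W}_{\mathcal{C}}(qT)+\mathcal{W}_{\mathcal{C}}(T)-(q^m-1)^{-1}W_n(\mathcal{C})\,q^n\,T^{n-d+1}$; 2. $\mathcal{W}^{\mathcal{S}}_{\mathcal{C}}(T)=\mathcal{W}_{\mathcal{C}}(T)-(q^m-1)^{-1}W_n(\mathcal{C})\,T^{n-d}$.
   Context: $W_t(\mathcal{C})$ is the number of elements of $\mathcal{C}$ of rank $t$, $W_{\mathcal{C}}(x,y)=\sum_{t=0}^nW_t(\mathcal{C})x^{n-t}y^t$; $d$ is the minimum rank of a nonzero element. Gaussian binomials $\begin{bmatrix} N\\ r\end{bmatrix}$ count $r$-dimensional subspaces of $\mathbb{F}_q^N$. The normalized weight enumerator is $\mathcal{W}_{\mathcal{C}}(T)=(q^m-1)^{-1}\sum_{i=d}^n\begin{bmatrix} n\\ i\end{bmatrix}^{-1}W_i(\mathcal{C})T^{i-d}$. For $f(x,y)=\sum_{i=0}^nf_ix^{n-i}y^i$ homogeneous of degree $n$ define the $q$-derivatives $D_x f=\sum_i f_i\begin{bmatrix} n-i\\ 1\end{bmatrix}x^{n-i-1}y^i$, $D_yf=\sum_if_i\begin{bmatrix} i\\ 1\end{bmatrix}x^{n-i}y^{i-1}$, $D_{q,x}f=\sum_if_iq^i\begin{bmatrix}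 n-i\\ 1\end{bmatrix}x^{n-i-1}y^i$, and the puncturing and shortening operators $\mathcal{P}=\begin{bmatrix} n\\ 1\end{bmatrix}^{-1}(D_{q,x}+D_y)$, $\mathcal{S}=\begin{bmatrix} n\\ 1\end{bmatrix}^{-1}D_x$. Write $\mathcal{P}(W_{\mathcal{C}})-x^{n-1}=\sum_{i}c_ix^{n-1-i}y^i$ and $\mathcal{S}(W_{\mathcal{C}})-x^{n-1}=\sum_ic'_ix^{n-1-i}y^i$. Then $\mathcal{W}^{\mathcal{P}}_{\mathcal{C}}(T)=(q^m-1)^{-1}\sum_{i=d-1}^{n-1}\begin{bmatrix} n-1\\ i\end{bmatrix}^{-1}c_iT^{i-d+1}$ (normalization of $\mathcal{P}(W_{\mathcal{C}})$ with length $n-1$ and distance $d-1$) and $\mathcal{W}^{\mathcal{S}}_{\mathcal{C}}(T)=(q^m-1)^{-1}\sum_{i=d}^{n-1}\begin{bmatrix} n-1\\ i\end{bmatrix}^{-1}c'_iT^{i-d}$ (normalization of $\mathcal{S}(W_{\mathcal{C}})$ with length $n-1$ and distance $d$). *)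

(* Defs.v *)
From HB Require Import structures.
From mathcomp Require Import all_boot all_order all_algebra all_field.
From mathcomp Require Export mpoly.

Set Implicit Arguments.
Unset Strict Implicit.
Unset Printing Implicit Defensive.

Import GRing.Theory.
Local Open Scope ring_scope.

(* Subspaces are stored as canonical generating matrices, so over a finite
   field there are finitely many of them. *)
Section FiniteSubspaces.

Import VectorInternalTheory.

Variables (F : finFieldType) (vT : vectType F).

HB.instance Definition _ := [Countable of @space F vT by <:].
HB.instance Definition _ := [Finite of @space F vT by <:].

End FiniteSubspaces.

Section RankMetricCode.

Variables (F : finFieldType) (m n : nat).

Definition rank_weight (C : {vspace 'M[F]_(m, n)}) (t : nat) : nat :=
  #|[set A : 'M[F]_(m, n) | (A \in C) && (\rank A == t)]|.

Definition is_min_rank_distance (C : {vspace 'M[F]_(m, n)}) (d : nat) : Prop :=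
  (exists A : 'M[F]_(m, n), [/\ A \in C, A != 0 & \rank A = d]) /\
  (forall A : 'M[F]_(m, n), A \in C -> A != 0 -> (d <= \rank A)%N).

End RankMetricCode.

Section Gaussian.

Variable F : finFieldType.

Definition gauss (N r : nat) : nat :=
  #|[set U : {vspace 'rV[F]_N} | \dim U == r]|.

End Gaussian.

(* The exponent of x^a y^b, where x = 'X_0 and y = 'X_1. *)
Definition mon_xy (a b : nat) : 'X_{1..2} := [multinom of [:: a; b]].

Definition xy (a b : nat) : {mpoly rat[2]} := 'X_[mon_xy a b].

(* f_i in f(x,y) = \sum_(i <= n) f_i x^(n-i) y^i. *)
Definition hcoef (n : nat) (f : {mpoly rat[2]}) (i : nat) : rat :=
  f@_(mon_xy (n - i) i).

(* The operators below are meant for f homogeneous of degree n; the terms in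
   which a truncated exponent such as n - i - 1 (i = n) or i.-1 (i = 0) occurs
   have coefficient gauss F 0 1 = 0. *)
Section QDerivatives.

Variables (F : finFieldType) (n : nat).
Implicit Type f : {mpoly rat[2]}.

Definition Dx f : {mpoly rat[2]} :=
  \sum_(0 <= i < n.+1)
     (hcoef n f i * (gauss F (n - i) 1)%:R) *: xy (n - i - 1) i.

Definition Dy f : {mpoly rat[2]} :=
  \sum_(0 <= i < n.+1) (hcoef n f i * (gauss F i 1)%:R) *: xy (n - i) i.-1.

Definition Dqx f : {mpoly rat[2]} :=
  \sum_(0 <= i < n.+1)
     (hcoef n f i * #|F|%:R ^+ i * (gauss F (n - i) 1)%:R) *: xy (n - i - 1) i.

Definition puncture f : {mpoly rat[2]} :=
  (gauss F n 1)%:R^-1 *: (Dqx f + Dy f).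

Definition shorten f : {mpoly rat[2]} :=
  (gauss F n 1)%:R^-1 *: Dx f.

End QDerivatives.

(* (q^m - 1)^-1 \sum_(e <= i <= N) [N, i]^-1 c_i T^(i-e): normalization, with
   length N and distance e, of the coefficient sequence c. *)
Definition normalization (F : finFieldType) (m N e : nat) (c : nat -> rat) :
    {poly rat} :=
  (#|F|%:R ^+ m - 1)^-1 *:
    \sum_(e <= i < N.+1) ((gauss F N i)%:R^-1 * c i) *: 'X^(i - e).

Section Enumerators.

Variables (F : finFieldType) (m n : nat) (C : {vspace 'M[F]_(m, n)}) (d : nat).

Definition weight_enum : {mpoly rat[2]} :=
  \sum_(0 <= t < n.+1) (rank_weight C t)%:R *: xy (n - t) t.

Definition norm_weight_enum : {poly rat} :=
  normalization F m n d (fun i => (rank_weight C i)%:R).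

Definition norm_weight_enum_P : {poly rat} :=
  normalization F m n.-1 d.-1
    (hcoef n.-1 (puncture F n weight_enum - xy n.-1 0)).

Definition norm_weight_enum_S : {poly rat} :=
  normalization F m n.-1 d
    (hcoef n.-1 (shorten F n weight_enum - xy n.-1 0)).

End Enumerators.

(* Main.v *)
(* The coefficient of x^(n-1-i) y^i in P(W_C) is
   [n,1]^-1 (q^i [n-i,1] W_i + [i+1,1] W_(i+1)), and in S(W_C) it is
   [n,1]^-1 [n-i,1] W_i.  The identities
     [n,1] [n-1,i] = [n,i] [n-i,1] = [n,i+1] [i+1,1]
   turn division by [n-1,i] into division by [n,i] and [n,i+1], so both claims
   hold coefficientwise.  The identities follow from counting frames: the free
   r-tuples in F^N number \prod_(i < r) (q^N - q^i), and each is a basis of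
   exactly one r-dimensional subspace. *)

Require Import Defs.
From mathcomp Require Import all_boot all_order all_algebra all_field.
From mathcomp Require Import mpoly.
From mathcomp Require Import ring zify.

Set Implicit Arguments.
Unset Strict Implicit.
Unset Printing Implicit Defensive.

Import GRing.Theory.
Local Open Scope ring_scope.

(** * Frame counts and Gaussian binomials over a finite field *)

Section GaussianCount.

Variable F : finFieldType.
Local Notation q := #|F|.

(** Truncated subtraction is harmless: for [r > N] the factor [i = N] is zero, and so is the
    product. *)
Definition card_frames (N r : nat) : nat := (\prod_(i < r) (q ^ N - q ^ i))%N.

(** Induction on [r]: once the tail [X] is chosen, the head ranges over [V] minus the span of [X],
    which leaves [q ^ \dim V - q ^ r] vectors. The subspace [V] is arbitrary because the count is
    applied both to the whole space and to each [r]-dimensional subspace. *)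
Lemma card_free_tuples (N r : nat) (V : {vspace 'rV[F]_N}) :
  #|[set X : r.-tuple 'rV[F]_N | free X && (<<X>> <= V)%VS]| =
  card_frames (\dim V) r.
Proof.
elim: r => [|r IHr].
  rewrite /card_frames big_ord0; apply/eqP/cards1P; exists [tuple].
  apply/setP => X; rewrite !inE tuple0 eqxx nil_free span_nil.
  by rewrite (sub0v V).
rewrite /card_frames big_ord_recr /= -/(card_frames _ r) -IHr.
rewrite -[LHS]sum1_card -[X in (X * _)%N]sum1_card.
rewrite (reindex (fun p : 'rV[F]_N * r.-tuple 'rV[F]_N =>
  [tuple of p.1 :: p.2]));
  last first.
  exists (fun X : r.+1.-tuple 'rV[F]_N => (thead X, [tuple of behead X])).
    by case=> v X _; congr (_, _); apply: val_inj.
  by move=> X _; rewrite /= -tuple_eta.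
rewrite big_distrl /=.
pose P (X : r.-tuple 'rV[F]_N) :=
  X \in [set Y : r.-tuple 'rV[F]_N | free Y && (<<Y>> <= V)%VS].
pose Q (X : r.-tuple 'rV[F]_N) v := (v \in V) && (v \notin <<X>>%VS).
transitivity (\sum_(X | P X) \sum_(v | Q X v) 1)%N.
  rewrite (exchange_big_dep predT) //= pair_big_dep; apply: eq_bigl => -[v X].
  rewrite /P /Q !inE /= free_cons span_cons subv_add -memvE.
  by case: (v \in V); case: (free X); case: (_ \in _); case: (_ <= _)%VS.
apply: eq_bigr => X; rewrite /P inE => /andP[freeX sXV].
have dimX : \dim <<X>> = r by rewrite (eqnP freeX) size_tuple.
rewrite mul1n sum1_card -[X in (_ - _ ^ X)%N]dimX -!card_vspace.
rewrite -cardsE -[X in (X - _)%N]cardsE -[X in (_ - X)%N]cardsE -cardsDS.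
  by apply: eq_card => v; rewrite !inE unfold_in /Q andbC.
by apply/subsetP => v; rewrite !inE; apply: subvP.
Qed.

Lemma gauss_card_frames (N r : nat) :
  (gauss F N r * card_frames r r = card_frames N r)%N.
Proof.
transitivity #|[set X : r.-tuple 'rV[F]_N | free X && (<<X>> <= fullv)%VS]|;
  last by rewrite card_free_tuples dimvf /dim /= mul1n.
rewrite /gauss -sum_nat_const -[RHS]sum1_card.
rewrite (partition_big (fun X : r.-tuple 'rV[F]_N => <<X>>%VS)
  (mem [set U : {vspace 'rV[F]_N} | \dim U == r])) /=; last first.
  by move=> X; rewrite !inE => /andP[freeX _]; rewrite (eqnP freeX) size_tuple.
apply: eq_bigr => U; rewrite inE => /eqP dimU.
(* The fibre over [U] consists of the frames inside [U]: by dimension, [r] free vectors of [U] span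
   it. *)
rewrite sum1_card -[r in card_frames r]dimU -card_free_tuples.
apply: eq_card => X; rewrite !inE unfold_in inE subvf andbT.
apply: andb_id2l => freeX; rewrite eqEdim.
by rewrite (eqnP freeX) size_tuple dimU leqnn andbT.
Qed.

Lemma card_frames_gt0 (N r : nat) : (r <= N)%N -> (0 < card_frames N r)%N.
Proof.
move=> le_rN; apply: prodn_gt0 => i.
by rewrite subn_gt0 ltn_exp2l ?finRing_gt1 // (leq_trans (ltn_ord i)).
Qed.

(** The factor [i = 0] splits off, and each of the other [r] factors gives up one [q]. *)
Lemma card_framesS (N r : nat) :
  card_frames N.+1 r.+1 = ((q ^ N.+1 - 1) * (q ^ r * card_frames N r))%N.
Proof.
rewrite /card_frames big_ord_recl expn0; congr (_ * _)%N.
have -> : (q ^ r = \prod_(i < r) q)%N by rewrite prod_nat_const card_ord.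
rewrite -big_split /=.
by apply: eq_bigr => i _; rewrite mulnBr !expnS.
Qed.

Lemma gauss_gt0 (N r : nat) : (r <= N)%N -> (0 < gauss F N r)%N.
Proof.
by move=> /card_frames_gt0; rewrite -gauss_card_frames muln_gt0 => /andP[].
Qed.

Lemma gaussnn (N : nat) : gauss F N N = 1%N.
Proof.
have := gauss_card_frames N N; rewrite -[RHS]mul1n => /eqP.
by rewrite eqn_pmul2r ?card_frames_gt0 // => /eqP.
Qed.

Lemma gaussn0 (N : nat) : gauss F N 0 = 1%N.
Proof. by have := gauss_card_frames N 0; rewrite /card_frames !big_ord0 muln1. Qed.

Lemma gauss1_card (N : nat) : (gauss F N 1 * (q - 1) = q ^ N - 1)%N.
Proof. by have := gauss_card_frames N 1; rewrite /card_frames !big_ord1 expn0 expn1. Qed.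

Lemma cardF_subn1_gt0 : (0 < q - 1)%N.
Proof. by rewrite subn_gt0 finRing_gt1. Qed.

Lemma cardF_exp_gt0 (r : nat) : (0 < q ^ r)%N.
Proof. by rewrite expn_gt0 (ltnW (finRing_gt1 F)). Qed.

(* Both sides count pairs (line, (r+1)-space containing it) in F^(N+1). *)
Lemma gaussSS (N r : nat) :
  (gauss F N.+1 1 * gauss F N r = gauss F N.+1 r.+1 * gauss F r.+1 1)%N.
Proof.
(* The multipliers [q - 1] and [card_frames r.+1 r.+1] allow each Gaussian binomial to be traded for
   a frame count. *)
apply/eqP; rewrite -(eqn_pmul2r cardF_subn1_gt0).
rewrite -(eqn_pmul2r (card_frames_gt0 (leqnn r.+1))); apply/eqP.
transitivity ((gauss F N.+1 1 * (q - 1)) * (q ^ r.+1 - 1) * q ^ r *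
  (gauss F N r * card_frames r r))%N; first by rewrite card_framesS; ring.
rewrite gauss1_card gauss_card_frames.
transitivity ((gauss F N.+1 r.+1 * card_frames r.+1 r.+1) *
  (gauss F r.+1 1 * (q - 1)))%N; last by ring.
by rewrite gauss_card_frames gauss1_card card_framesS; ring.
Qed.

(** After multiplication by [q - 1], [card_frames r r] and [q ^ r], both sides equal
    [card_frames N.+1 r.+1]: the left side splits off the first factor of that product, the right
    side the last one, [q ^ N.+1 - q ^ r]. *)
Lemma gaussSl (N r : nat) : (r <= N.+1)%N ->
  (gauss F N.+1 1 * gauss F N r = gauss F N.+1 r * gauss F (N.+1 - r) 1)%N.
Proof.
move=> le_rN; apply/eqP; rewrite -(eqn_pmul2r cardF_subn1_gt0).
rewrite -(eqn_pmul2r (card_frames_gt0 (leqnn r))).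
rewrite -(eqn_pmul2r (cardF_exp_gt0 r)); apply/eqP.
transitivity ((gauss F N.+1 1 * (q - 1)) *
  (q ^ r * (gauss F N r * card_frames r r)))%N; first by ring.
rewrite gauss1_card gauss_card_frames -card_framesS /card_frames big_ord_recr /=.
rewrite -/(card_frames _ _) -gauss_card_frames -[in (q ^ N.+1)%N](subnK le_rN).
rewrite expnD -[X in (_ * (_ - X))%N]mul1n -mulnBl -gauss1_card; ring.
Qed.

End GaussianCount.

(** * Coefficient extraction in two variables *)

Lemma mon_xy_eq (a b a' b' : nat) :
  (mon_xy a b == mon_xy a' b') = (a == a') && (b == b').
Proof. by rewrite -val_eqE -val_eqE /= !eqseq_cons eqxx andbT. Qed.

Lemma hcoef_xy (n a b i : nat) :
  hcoef n (xy a b) i = ((a == n - i) && (b == i))%N%:R.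
Proof. by rewrite /hcoef /xy mcoeffX mon_xy_eq. Qed.

Lemma hcoefD n f g i : hcoef n (f + g) i = hcoef n f i + hcoef n g i.
Proof. exact: mcoeffD. Qed.

Lemma hcoefB n f g i : hcoef n (f - g) i = hcoef n f i - hcoef n g i.
Proof. exact: mcoeffB. Qed.

Lemma hcoefZ n c f i : hcoef n (c *: f) i = c * hcoef n f i.
Proof. exact: mcoeffZ. Qed.

(** Serves the three derivatives and the weight enumerator alike: each is a sum of monomials in
    which only one index [j] hits the wanted exponent. *)
Lemma hcoef_sum_xy (n N i j : nat) (c : nat -> rat) (a b : nat -> nat) :
    (j < N)%N -> a j = (n - i)%N -> b j = i ->
    (forall l, (l < N)%N -> l != j -> ~~ ((a l == n - i) && (b l == i))%N) ->
  hcoef n (\sum_(0 <= l < N) c l *: xy (a l) (b l)) i = c j.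
Proof.
move=> ltjN aj bj uniq_j.
rewrite /hcoef raddf_sum /= big_mkord (bigD1 (Ordinal ltjN)) //= big1 ?addr0.
  by rewrite -/(hcoef _ _ _) hcoefZ hcoef_xy aj bj !eqxx mulr1.
move=> l ne_lj; rewrite -/(hcoef _ _ _) hcoefZ hcoef_xy.
by rewrite (negbTE (uniq_j _ _ _)) ?mulr0.
Qed.

(** * Coefficients of the derivatives, and basic facts on rank weights *)

Section Coefficients.

Variables (F : finFieldType) (m n : nat).
Implicit Type f : {mpoly rat[2]}.

Lemma hcoef_Dx f i : (i <= n)%N ->
  hcoef n (Dx F n.+1 f) i = hcoef n.+1 f i * (gauss F (n.+1 - i) 1)%:R.
Proof.
move=> le_in.
apply: (@hcoef_sum_xy _ _ _ i) => [||//|l lt_l ne_li]; [lia | lia |].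
by rewrite (negbTE ne_li) andbF.
Qed.

Lemma hcoef_Dqx f i : (i <= n)%N ->
  hcoef n (Dqx F n.+1 f) i =
  hcoef n.+1 f i * #|F|%:R ^+ i * (gauss F (n.+1 - i) 1)%:R.
Proof.
move=> le_in.
apply: (@hcoef_sum_xy _ _ _ i) => [||//|l lt_l ne_li]; [lia | lia |].
by rewrite (negbTE ne_li) andbF.
Qed.

Lemma hcoef_Dy f i : (i <= n)%N ->
  hcoef n (Dy F n.+1 f) i = hcoef n.+1 f i.+1 * (gauss F i.+1 1)%:R.
Proof.
move=> le_in.
(* For [i = 0] the indices 0 and 1 share the [y]-exponent 0, since [0.-1 = 0]; the [x]-exponent
   tells them apart. *)
by apply: (@hcoef_sum_xy _ _ _ i.+1) => [|||l lt_l ne_li]; lia.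
Qed.

Lemma hcoef_weight_enum (C : {vspace 'M[F]_(m, n)}) i : (i <= n)%N ->
  hcoef n (weight_enum C) i = (rank_weight C i)%:R.
Proof.
move=> le_in.
apply: (@hcoef_sum_xy _ _ _ i) => [|//|//|l lt_l ne_li]; first lia.
by rewrite (negbTE ne_li) andbF.
Qed.

Lemma rank_weight0 (C : {vspace 'M[F]_(m, n)}) : rank_weight C 0 = 1%N.
Proof.
apply/eqP/cards1P; exists 0; apply/setP => A.
by rewrite !inE mxrank_eq0 andb_idl // => /eqP->; apply: mem0v.
Qed.

Lemma rank_weight_lt_min (C : {vspace 'M[F]_(m, n)}) d i :
  is_min_rank_distance C d -> (0 < i < d)%N -> rank_weight C i = 0%N.
Proof.
move=> [_ min_d] /andP[i_gt0 lt_id]; apply/eqP; rewrite cards_eq0.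
apply/eqP/setP => A; rewrite !inE; apply/negP => /andP[CA /eqP rankA].
have: A != 0 by rewrite -mxrank_eq0 rankA -lt0n.
by move/(min_d A CA); rewrite rankA leqNgt lt_id.
Qed.

Lemma min_rank_distance_bounds (C : {vspace 'M[F]_(m, n)}) d :
  is_min_rank_distance C d -> (0 < d <= n)%N.
Proof.
by move=> [[A [_ nzA <-]] _]; rewrite lt0n mxrank_eq0 nzA rank_leq_col.
Qed.

End Coefficients.

(** * The Gaussian identities in divided form *)

Section GaussianRat.

Variable F : finFieldType.

Lemma gaussR_neq0 (N r : nat) : (r <= N)%N -> (gauss F N r)%:R != 0 :> rat.
Proof. by move=> /(gauss_gt0 F); rewrite Num.Theory.pnatr_eq0 lt0n. Qed.

Lemma gaussSS_inv (N r : nat) : (r <= N)%N ->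
  (gauss F N r)%:R^-1 * ((gauss F N.+1 1)%:R^-1 * (gauss F r.+1 1)%:R) =
  (gauss F N.+1 r.+1)%:R^-1 :> rat.
Proof.
move=> le_rN.
have /(congr1 (fun k => k%:R : rat)) := gaussSS F N r; rewrite !natrM => eqg.
have nz1 := gaussR_neq0 le_rN; have nz2 := @gaussR_neq0 N.+1 1 isT.
have nz3 := @gaussR_neq0 N.+1 r.+1 le_rN.
by rewrite mulrCA mulrA -invfM eqg invfM -mulrA mulVf ?mulr1 // gaussR_neq0.
Qed.

(** The range stops at [r = N] so that [gauss F (N.+1 - r) 1] is nonzero and cancels. *)
Lemma gaussSl_inv (N r : nat) : (r <= N)%N ->
  (gauss F N r)%:R^-1 * ((gauss F N.+1 1)%:R^-1 * (gauss F (N.+1 - r) 1)%:R) =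
  (gauss F N.+1 r)%:R^-1 :> rat.
Proof.
move=> le_rN.
have /(congr1 (fun k => k%:R : rat)) := gaussSl F (leqW le_rN).
rewrite !natrM => eqg.
rewrite mulrCA mulrA -invfM eqg invfM -mulrA mulVf ?mulr1 //.
by rewrite gaussR_neq0 // subn_gt0.
Qed.

End GaussianRat.

Theorem theorem6p10 (F : finFieldType) (m n d : nat)
    (hn : (2 <= n)%N) (hnm : (n <= m)%N)
    (C : {vspace 'M[F]_(m, n)}) (hC : C != 0%VS)
    (hd : is_min_rank_distance C d) :
  let q : rat := #|F|%:R in
  norm_weight_enum_P C d =
    q ^+ d *: ('X * (norm_weight_enum C d \Po (q *: 'X)))
    + norm_weight_enum C d
    - ((q ^+ m - 1)^-1 * (rank_weight C n)%:R * q ^+ n) *: 'X^(n - d + 1)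
  /\
  norm_weight_enum_S C d =
    norm_weight_enum C d
    - ((q ^+ m - 1)^-1 * (rank_weight C n)%:R) *: 'X^(n - d).
Proof.
move=> q; have /andP[d_gt0 le_dn] := min_rank_distance_bounds hd.
case: n hn hnm C hC hd le_dn => // N _ _ C _ hd le_dN.
case: d d_gt0 hd le_dN => // e _ hd le_eN.
pose a i : rat := (gauss F N.+1 i)%:R^-1 * (rank_weight C i)%:R.
(* As [gauss F n n = 1], the top coefficient is [W_n] itself, so the correction terms carry no
   Gaussian binomial. *)
have aN : a N.+1 = (rank_weight C N.+1)%:R by rewrite /a gaussnn invr1 mul1r.
rewrite /norm_weight_enum_P /norm_weight_enum_S /norm_weight_enum /normalization /=.
rewrite -!scalerA -aN; split; last first.
  (* Shortening: the correction removes the index [n]. The term [x^(n-1)] affects only the index 0,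
     which lies below the range. *)
  rewrite [in RHS]big_nat_recr //= scalerDr addrK.
  congr (_ *: _); apply: eq_big_nat => i /andP[lt_ei le_iN].
  rewrite hcoefB hcoefZ hcoef_Dx // hcoef_weight_enum 1?ltnW // hcoef_xy.
  have -> : (0%N == i) = false by lia.
  by rewrite andbF subr0 -(@gaussSl_inv F N i le_iN); congr (_ *: _); ring.
(* The leading 1 of [W_C] is cancelled by [- x^(n-1)] when [d = 1]; otherwise
   the coefficient of index [d - 1] of [W_C] vanishes. *)
have coefP i : (e <= i < N.+1)%N ->
    (gauss F N i)%:R^-1 *
      hcoef N (puncture F N.+1 (weight_enum C) - xy N 0) i =
    (if i == e then 0 else q ^+ i * a i) + a i.+1.
  move=> /andP[le_ei le_iN].
  rewrite hcoefB hcoefZ hcoefD hcoef_Dqx // hcoef_Dy //.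
  rewrite !hcoef_weight_enum ?(ltnW le_iN) //.
  rewrite hcoef_xy.
  transitivity ((gauss F N.+1 i)%:R^-1 * (q ^+ i * (rank_weight C i)%:R)
     + (gauss F N.+1 i.+1)%:R^-1 * (rank_weight C i.+1)%:R
     - (gauss F N i)%:R^-1 * ((N == N - i) && (0 == i))%N%:R).
    rewrite -(@gaussSS_inv F N i le_iN) -(@gaussSl_inv F N i le_iN); ring.
  rewrite -/(a i.+1) addrAC; congr (_ + _).
  case: (eqVneq i e) => [->|ne_ie]; last first.
    have -> : (0%N == i) = false by lia.
    by rewrite andbF mulr0 subr0 mulrCA.
  case: (posnP e) => [->|e_gt0].
    by rewrite subn0 !eqxx rank_weight0 !gaussn0 invr1 expr0 !mulr1 subrr.
  have -> : (0%N == e) = false by lia.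
  by rewrite andbF (rank_weight_lt_min hd) ?e_gt0 ?leqnn // !mulr0 subr0.
under eq_big_nat => i lt_i do rewrite (coefP i lt_i) scalerDl.
(* The summands [a i.+1] give the enumerator itself after an index shift; the others give the
   substituted one minus the correction. *)
rewrite big_split scalerDr /= [in RHS]addrAC; congr (_ + _); last first.
  by rewrite [in RHS]big_add1.
rewrite comp_polyZ -/q -scalerAr [q ^+ e.+1 *: _]scalerA.
rewrite [q ^+ e.+1 * _]mulrC -scalerA -scalerBr.
congr (_ *: _).
(* On the left the index [e = d - 1] contributes zero; on the right the index [n] will cancel
   against the correction. Both sums then run over [d <= i < n]. *)
rewrite big_ltn // eqxx scale0r add0r linear_sum /= mulr_sumr scaler_sumr.
rewrite [in RHS]big_nat_recr //=.
have term i : (e < i)%N ->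
    q ^+ e.+1 *: ('X * ((a i *: 'X^(i - e.+1)) \Po (q *: 'X))) =
    (q ^+ i * a i) *: 'X^(i - e).
  move=> lt_ei; rewrite comp_polyZ comp_Xn_poly exprZn -!scalerAr -exprS !scalerA.
  have -> : q ^+ i = q ^+ e.+1 * q ^+ (i - e.+1) by rewrite -exprD subnKC.
  by rewrite -subSn // subSS; congr (_ *: _); ring.
rewrite term // scalerA [a N.+1 * _]mulrC subSS addn1 subSn // addrK.
apply: eq_big_nat => i /andP[lt_ei _].
by rewrite -/(a i) term // gtn_eqF.
Qed.
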